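(* Let $K$ be a finite set with $|K|\ge2$, $C,D$ nonempty countable sets, and $\varepsilon\geq 0$. Suppose that $u\in\Delta(K\times C\times D)$ exhibits $\varepsilon$-knowledge of the state and that $v\in\Delta(K\times K_C\times K_D)$, where $K_C=K_D=K$, satisfies $\mathrm{marg}_Kv=\mathrm{marg}_Ku$ and $v(k=k_C=k_D)=1$. Then $d(u,v)\le20\,\varepsilon$.
   Context: An information structure is a probability on triples (state $k\in K$, signal of player 1, signal of player 2) with countably many signals; player 1 is the maximizer, player 2 the minimizer. In $v$ the signals of players 1 and 2 are $k_C\in K_C$ and $k_D\in K_D$. $u\in\Delta(K\times C\times D)$ exhibits $\varepsilon$-knowledge of the state if there is a map $\kappa:C\sqcup D\to K$ such that $u\big(\{c:\ u(k=\kappa(c)\mid c)\ge1-\varepsilon\}\big)\ge1-\varepsilon$ and $u\big(\{d:\ u(k=\kappa(d)\mid d)\ge1-\varepsilon\}\big)\ge1-\varepsilon$. A payoff function is a map $g:K\times I\times J\to[-1,1]$ with $I,J$ finite nonempty sets; $\mathcal G$ is the set of all payoff functions. $\mathrm{val}(u,g)$ is the value of the zero-sum Bayesian game in which the state and signals are drawn from $u$, each player learns his own signal, they simultaneously choose $i\in I$, $j\in J$ (mixed actions depending on own signal allowed), and player 1 receives $g(k,i,j)$ from player 2. $d(u,v)=\sup_{g\in\mathcal G}|\mathrm{val}(u,g)-\mathrm{val}(v,g)|$. $\mathrm{marg}_K$ denotes the marginal on $K$. *)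

(* Defs.v *)
From HB Require Import structures.
From mathcomp Require Import all_boot all_order all_algebra.
From mathcomp Require Import all_classical all_reals all_analysis.

Set Implicit Arguments.
Unset Strict Implicit.
Unset Printing Implicit Defensive.

Import Order.TTheory GRing.Theory Num.Theory.
Import numFieldNormedType.Exports.

Local Open Scope classical_set_scope.
Local Open Scope ring_scope.

(* Nonempty countable and nonempty finite sets.  The distinguished point only
   witnesses nonemptiness, which measurable types require. *)
#[short(type="pointedCountType")]
HB.structure Definition PointedCountable := {T of Countable T & isPointed T}.

#[short(type="pointedFinType")]
HB.structure Definition PointedFinite := {T of Finite T & isPointed T}.

(* Triples (state, signal of player 1, signal of player 2), with the
   sigma-algebra of all subsets: with countable components, a probability on
   this space is an arbitrary probability mass function on K * C * D.  For
   x = (k, c, d), x.1.1 = k, x.1.2 = c and x.2 = d. *)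
Definition info_space (K C D : pointedType) : Type := (K * C * D)%type.

HB.instance Definition _ (K C D : pointedType) :=
  Pointed.copy (info_space K C D) (K * C * D)%type.
HB.instance Definition _ (K C D : pointedType) :=
  @isMeasurable.Build default_measure_display (info_space K C D)
    discrete_measurable discrete_measurable0
    discrete_measurableC discrete_measurableU.

Definition info_structure (R : realType) (K : pointedFinType)
    (C D : pointedCountType) : Type :=
  probability (info_space K C D) R.

Section InformationStructure.
Context {R : realType} {K : pointedFinType} {C D : pointedCountType}.
Implicit Type u : info_structure R K C D.

Definition marg_state u (k : K) : \bar R :=
  u [set x : info_space K C D | x.1.1 = k].

(* The value when u B = 0 is irrelevant below: such signals have total mass 0. *)
Definition cond_prob u (A B : set (info_space K C D)) : R :=
  fine (u (A `&` B)) / fine (u B).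

Definition eps_knowledge (eps : R) u : Prop :=
  exists kappa : C + D -> K,
    ((1 - eps)%:E <= u [set x : info_space K C D |
       (1 - eps <= cond_prob u [set y | y.1.1 = kappa (inl x.1.2)]
                               [set y | y.1.2 = x.1.2])%R])%E /\
    ((1 - eps)%:E <= u [set x : info_space K C D |
       (1 - eps <= cond_prob u [set y | y.1.1 = kappa (inr x.2)]
                               [set y | y.2 = x.2])%R])%E.

End InformationStructure.

Definition behavior_strategy (R : realType) (S : Type) (A : finType) :
    set (S -> A -> R) :=
  [set s | forall c, (forall a, 0 <= s c a) /\ \sum_a s c a = 1].
Arguments behavior_strategy R S A : clear implicits.

Section Game.
Context {R : realType} {K : pointedFinType} {C D : pointedCountType}.
Context {I J : finType}.

Definition expected_payoff (u : info_structure R K C D) (g : K -> I -> J -> R)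
    (s : C -> I -> R) (t : D -> J -> R) : R :=
  \int[u]_x (\sum_i \sum_j s x.1.2 i * t x.2 j * g x.1.1 i j).

(* The value, as the maxmin of the expected payoff; for nonempty I and J and
   bounded g it coincides with the minmax. *)
Definition game_value (u : info_structure R K C D) (g : K -> I -> J -> R) : R :=
  sup [set inf [set expected_payoff u g s t | t in behavior_strategy R D J]
      | s in behavior_strategy R C I].

End Game.

Definition payoff_function (R : realType) (K : Type) (I J : finType)
    (g : K -> I -> J -> R) : Prop :=
  [/\ (0 < #|I|)%N, (0 < #|J|)%N & forall k i j, -1 <= g k i j <= 1].

Definition value_dist (R : realType) (K : pointedFinType)
    (C D C' D' : pointedCountType)
    (u : info_structure R K C D) (v : info_structure R K C' D') : \bar R :=
  ereal_sup [set r | exists (I J : finType) (g : K -> I -> J -> R),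
    payoff_function g /\ r = (`|game_value u g - game_value v g|)%:E].

(* Main.v *)
Require Import Defs.
From mathcomp Require Import all_boot all_order all_algebra.
From mathcomp Require Import all_classical all_reals all_analysis.
From mathcomp Require Import lra.

Import Order.TTheory GRing.Theory Num.Theory.
Local Open Scope classical_set_scope.
Local Open Scope ring_scope.

Set Implicit Arguments.
Unset Strict Implicit.
Unset Printing Implicit Defensive.

(** When player 2 guesses the state as kappa(d), the guess is wrong with
    probability at most 2 eps: the signals d whose guess is reliable have mass
    at least 1 - eps, and each of them is right with conditional probability at
    least 1 - eps ([guess_correct_mass]).  The same holds for player 1.

    Under v both players know the state, so an expected payoff only depends on
    how each of them plays in each state ([expected_payoff_revealed]).  The two
    games are compared through their maxmin values, by transporting strategies.
    - A strategy t' of player 2 in v is imitated in u by playing t'(kappa(d)).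
      If the guesses were always right, player 1's own strategy s would only
      matter through the average of s(c) given k, because the payoff is linear
      in the mixed action of player 1 once player 2's depends on k alone.  This
      average is a strategy s' in v.  Wrong guesses change a payoff in [-1, 1]
      by at most 2, so the payoff of (s, t' o kappa) in u exceeds that of
      (s', t') in v by at most 4 eps.
    - Symmetrically, player 1 imitates s' in u by s'(kappa(c)), and every reply
      t of player 2 in u averages to a reply in v.
    The first transport bounds the value of u above ([game_value_le_revealed]),
    the second bounds it below ([revealed_le_game_value]).  In each only the
    imitating player needs to know the state, and no minmax theorem intervenes
    since both values are compared as maxmins.  The distance is thus at most
    4 eps. *)

(** * Comparison of maxmin values *)

(** Each maximizer's choice s in the first problem is matched by a choice s'
    in the second, against which every reply t' can be turned back into a
    reply t to s.  The bound M keeps the infima and suprema meaningful, as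
    [inf] and [sup] take a default value on unbounded sets. *)
Lemma maxmin_le (R : realType) (S T S' T' : Type) (X : set S) (Y : set T)
    (X' : set S') (Y' : set T') (P : S -> T -> R) (P' : S' -> T' -> R)
    (M delta : R) :
  X !=set0 -> Y' !=set0 ->
  (forall s t, X s -> Y t -> `|P s t| <= M) ->
  (forall s t, X' s -> Y' t -> `|P' s t| <= M) ->
  (forall s, X s -> exists2 s', X' s' &
     forall t', Y' t' -> exists2 t, Y t & P s t <= P' s' t' + delta) ->
  sup [set inf [set P s t | t in Y] | s in X] <=
  sup [set inf [set P' s t | t in Y'] | s in X'] + delta.
Proof.
move=> [s0 Xs0] [t0 Yt0] bP bP' sim; apply: ge_sup.
  by exists (inf [set P s0 t | t in Y]), s0.
move=> _ [s Xs <-]; have [s' Xs' resp] := sim s Xs.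
rewrite -lerBlDr; apply: (@le_trans _ _ (inf [set P' s' t | t in Y'])).
  apply: lb_le_inf; first by exists (P' s' t0), t0.
  move=> _ [t' Yt' <-]; have [t Yt le_st] := resp t' Yt'.
  rewrite lerBlDr; apply: le_trans le_st; apply: ge_inf; last by exists t.
  by exists (- M) => _ [q Yq <-]; have := bP _ _ Xs Yq;
    rewrite ler_norml => /andP[].
apply: ub_le_sup; last by exists s'.
exists M => _ [q Xq <-]; apply: (@le_trans _ _ (P' q t0)); last first.
  by apply: le_trans (ler_norm _) (bP' _ _ Xq Yt0).
apply: ge_inf; last by exists t0.
by exists (- M) => _ [r Yr <-]; have := bP' _ _ Xq Yr;
  rewrite ler_norml => /andP[].
Qed.

(** * Mixed actions and stage payoffs *)

Definition mixed (R : realType) (A : finType) (p : A -> R) : Prop :=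
  (forall a, 0 <= p a) /\ \sum_a p a = 1.

Lemma mixed_le1 (R : realType) (A : finType) (p : A -> R) a :
  mixed p -> p a <= 1.
Proof.
move=> [p0 <-]; rewrite (bigD1 a)//= lerDl; apply: sumr_ge0 => b _; exact: p0.
Qed.

Lemma behavior_strategy_nonempty (R : realType) (S : Type) (A : finType) :
  (0 < #|A|)%N -> behavior_strategy R S A !=set0.
Proof.
move=> /card_gt0P[a0 _]; exists (fun _ a => (a == a0)%:R) => c; split => //.
rewrite (bigD1 a0)//= eqxx big1 ?addr0// => a /negbTE ->.
by [].
Qed.

Definition stage_payoff (R : realType) (I J : finType) (h : I -> J -> R)
    (p : I -> R) (q : J -> R) : R :=
  \sum_i \sum_j p i * q j * h i j.

Lemma stage_payoff_le1 (R : realType) (I J : finType) (h : I -> J -> R) p q :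
  (forall i j, -1 <= h i j <= 1) -> mixed p -> mixed q ->
  `|stage_payoff h p q| <= 1.
Proof.
move=> h1 [p0 p1] [q0 q1]; apply: (@le_trans _ _ (\sum_i \sum_j p i * q j)).
  apply: le_trans (ler_norm_sum _ _ _) _; apply: ler_sum => i _.
  apply: le_trans (ler_norm_sum _ _ _) _; apply: ler_sum => j _.
  rewrite normrM ger0_norm ?mulr_ge0// ler_piMr ?mulr_ge0//.
  by rewrite ler_norml.
by under eq_bigr do rewrite -mulr_sumr q1 mulr1; rewrite p1.
Qed.

Lemma stage_payoff_row (R : realType) (I J : finType) (h : I -> J -> R) p q :
  stage_payoff h p q = \sum_i (\sum_j q j * h i j) * p i.
Proof.
apply: eq_bigr => i _; rewrite mulr_suml; apply: eq_bigr => j _.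
by rewrite -mulrA mulrC.
Qed.

Lemma stage_payoff_col (R : realType) (I J : finType) (h : I -> J -> R) p q :
  stage_payoff h p q = \sum_j (\sum_i p i * h i j) * q j.
Proof.
rewrite /stage_payoff exchange_big; apply: eq_bigr => j _.
by rewrite mulr_suml; apply: eq_bigr => i _; rewrite mulrAC.
Qed.

(** * Expectations under an information structure *)

Lemma info_integrable (R : realType) (K : pointedFinType)
    (C D : pointedCountType) (u : info_structure R K C D)
    (f : info_space K C D -> R) (M : R) :
  (forall x, `|f x| <= M) -> u.-integrable setT (EFin \o f).
Proof.
move=> fM; apply: measurable_bounded_integrable => //.
  by apply: (@le_lt_trans _ _ 1%E); [exact: probability_le1|exact: ltry].
exists M; split; first exact: num_real.
by move=> y My x _; exact: le_trans (fM x) (ltW My).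
Qed.

Lemma info_fineK (R : realType) (K : pointedFinType)
    (C D : pointedCountType) (u : info_structure R K C D)
    (A : set (info_space K C D)) : ((fine (u A))%:E = u A)%E.
Proof. by rewrite fineK// fin_num_measure. Qed.

Lemma expect_indic (R : realType) (K : pointedFinType)
    (C D : pointedCountType) (u : info_structure R K C D)
    (A : set (info_space K C D)) : \int[u]_x \1_A x = fine (u A).
Proof. by rewrite /Rintegral integral_indic// setIT. Qed.

Lemma expect_sum (R : realType) (K : pointedFinType)
    (C D : pointedCountType) (u : info_structure R K C D) (I : finType)
    (c : I -> R) (f : I -> info_space K C D -> R) :
  (forall i x, `|f i x| <= 1) ->
  \int[u]_x (\sum_i c i * f i x) = \sum_i c i * \int[u]_x f i x.
Proof.
move=> f1; have intf i : u.-integrable setT (EFin \o (fun x => c i * f i x)).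
  apply: (@info_integrable _ _ _ _ _ _ `|c i|) => x.
  by rewrite normrM ler_piMr.
transitivity (\sum_i \int[u]_x (c i * f i x)); last first.
  by apply: eq_bigr => i _; rewrite RintegralZl//; exact: info_integrable.
rewrite {1}/Rintegral; under eq_integral do rewrite -sumEFin.
rewrite integral_sum//.
rewrite -sum_fine// => i _.
by apply: integrable_fin_num => //; exact: intf.
Qed.

(** Off A two payoffs in [-1, 1] differ by at most 2, hence
    f <= f' + 2 * \1_(~` A) everywhere. *)
Lemma expect_le_of_likely (R : realType) (K : pointedFinType)
    (C D : pointedCountType) (u : info_structure R K C D)
    (A : set (info_space K C D)) (f f' : info_space K C D -> R) (delta : R) :
  (forall x, `|f x| <= 1) -> (forall x, `|f' x| <= 1) ->
  (forall x, A x -> f x = f' x) -> ((1 - delta)%:E <= u A)%E ->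
  \int[u]_x f x <= \int[u]_x f' x + 2 * delta.
Proof.
move=> f1 f'1 ff' uA.
have i1 : u.-integrable setT (EFin \o f) by exact: info_integrable f1.
have i2 : u.-integrable setT (EFin \o f') by exact: info_integrable f'1.
have i3 : u.-integrable setT (EFin \o (\1_(~` A) : info_space K C D -> R)).
  apply: (@info_integrable _ _ _ _ _ _ 1) => x; rewrite indicE.
  by case: (_ \in _); rewrite /= ?normr1 ?normr0.
have i4 : u.-integrable setT (EFin \o (fun x => 2 * (\1_(~` A) x : R))).
  apply: (@info_integrable _ _ _ _ _ _ 2) => x; rewrite indicE.
  by case: (_ \in _); rewrite /= ?mulr1 ?mulr0 ?normr0 ?ger0_norm.
have i5 : u.-integrable setT (EFin \o (fun x => f' x + 2 * \1_(~` A) x)).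
  apply: (@info_integrable _ _ _ _ _ _ 3) => x; rewrite indicE.
  have := f'1 x; rewrite !ler_norml; case: (_ \in _) => /=; lra.
apply: (@le_trans _ _ (\int[u]_x (f' x + 2 * \1_(~` A) x))).
  apply: le_Rintegral => // x _; rewrite indicE.
  have [Ax|nAx] := pselect (A x).
    by rewrite ff'// lerDl mulr_ge0.
  rewrite mem_set//=; move: (f1 x) (f'1 x); rewrite !ler_norml; lra.
rewrite RintegralD// RintegralZl// expect_indic lerD2l ler_pM2l//.
rewrite probability_setC//; move: uA; rewrite -info_fineK -EFinB !lee_fin /=.
lra.
Qed.

(** * Averaging a strategy over signals, given the state *)

Definition state_mass (R : realType) (K : pointedFinType)
    (C D : pointedCountType) (u : info_structure R K C D) (k : K) : R :=
  fine (marg_state u k).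

Lemma expect_state (R : realType) (K : pointedFinType)
    (C D : pointedCountType) (u : info_structure R K C D) (k : K) :
  \int[u]_x (x.1.1 == k)%:R = state_mass u k.
Proof.
rewrite /state_mass /marg_state -expect_indic; apply: eq_Rintegral => x _.
rewrite indicE; congr (nat_of_bool _)%:R.
by apply/eqP/idP => [|/set_mem//]; move=> ?; apply/mem_set.
Qed.

Lemma expect_fun_state (R : realType) (K : pointedFinType)
    (C D : pointedCountType) (u : info_structure R K C D) (h : K -> R) :
  \int[u]_x h x.1.1 = \sum_k state_mass u k * h k.
Proof.
under eq_bigr do rewrite -expect_state mulrC.
rewrite -expect_sum; last first.
  by move=> k x; case: eqP => _; rewrite ?normr1 ?normr0.
apply: eq_Rintegral => x _; rewrite (bigD1 x.1.1)//= eqxx mulr1 big1 ?addr0//.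
by move=> k; rewrite eq_sym => /negbTE ->; rewrite mulr0.
Qed.

(** The conditional expectation of the mixed action t(sig) given the state k.
    On states of mass zero any mixed action would do; the one played at an
    arbitrary signal keeps this a strategy. *)
Definition cond_strategy (R : realType) (K : pointedFinType)
    (C D : pointedCountType) (u : info_structure R K C D)
    (S : Type) (sig : info_space K C D -> S) (A : finType) (t : S -> A -> R)
    (k : K) (a : A) : R :=
  if state_mass u k == 0 then t (sig point) a
  else (\int[u]_x ((x.1.1 == k)%:R * t (sig x) a)) / state_mass u k.

Section cond_strategy_lemmas.
Context (R : realType) (K : pointedFinType) (C D : pointedCountType).
Context (u : info_structure R K C D) (S : Type) (sig : info_space K C D -> S).
Context (A : finType) (t : S -> A -> R) (tP : behavior_strategy R S A t).

Lemma state_weight_le1 (k : K) a x : `|(x.1.1 == k)%:R * t (sig x) a| <= 1.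
Proof.
have [t0 t1] := tP (sig x); rewrite normrM (ger0_norm (t0 a)).
case: eqP => _; rewrite ?normr1 ?normr0 ?mul0r// mul1r.
exact: mixed_le1 (tP (sig x)).
Qed.

(** The product form of the conditional expectation, valid on all states: when k
    has mass zero, the integral is squeezed between 0 and that mass. *)
Lemma state_mass_cond_strategy k a :
  state_mass u k * cond_strategy u sig t k a =
  \int[u]_x ((x.1.1 == k)%:R * t (sig x) a).
Proof.
rewrite /cond_strategy; have [p0|p0] := eqVneq (state_mass u k) 0; last first.
  by rewrite mulrC divfK.
rewrite p0 mul0r; apply/esym/eqP; rewrite eq_le; apply/andP; split; last first.
  by apply: Rintegral_ge0 => x _; rewrite mulr_ge0//; case: (tP (sig x)).
rewrite -p0 -expect_state; apply: le_Rintegral => //.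
- by apply: info_integrable => x; exact: state_weight_le1.
- apply: (@info_integrable _ _ _ _ _ _ 1) => x.
  by case: eqP => _; rewrite ?normr1 ?normr0.
- by move=> x _; rewrite ler_piMr//; exact: mixed_le1 (tP (sig x)).
Qed.

Lemma cond_strategyP : behavior_strategy R K A (cond_strategy u sig t).
Proof.
move=> k; split => [a|].
  rewrite /cond_strategy; case: ifP => _; first by case: (tP (sig point)).
  rewrite divr_ge0//; last by rewrite fine_ge0.
  by apply: Rintegral_ge0 => x _; rewrite mulr_ge0//; case: (tP (sig x)).
have [p0|p0] := eqVneq (state_mass u k) 0.
  by rewrite /cond_strategy p0 eqxx; case: (tP (sig point)).
apply: (mulfI p0); rewrite mulr1 mulr_sumr.
under eq_bigr do rewrite state_mass_cond_strategy -[\int[u]_x _]mul1r.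
rewrite -(@expect_sum _ _ _ _ _ _ (fun=> 1)); last first.
  by move=> a x; exact: state_weight_le1.
rewrite -expect_state; apply: eq_Rintegral => x _.
under eq_bigr do rewrite mul1r; rewrite -mulr_sumr.
by case: (tP (sig x)) => _ ->; rewrite mulr1.
Qed.

(** An expectation linear in the mixed action, with coefficients depending on
    the state alone, sees the strategy only through its conditional averages. *)
Lemma expect_cond_strategy (F : K -> A -> R) :
  \int[u]_x (\sum_a F x.1.1 a * t (sig x) a) =
  \sum_k state_mass u k * \sum_a F k a * cond_strategy u sig t k a.
Proof.
(* Splitting along the state makes the coefficients constant, so that the
   expectation can be taken termwise. *)
transitivity (\int[u]_x (\sum_(ka : K * A) F ka.1 ka.2 *
    ((x.1.1 == ka.1)%:R * t (sig x) ka.2))).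
  apply: eq_Rintegral => x _.
  rewrite -(pair_bigA _ (fun k a => F k a * ((x.1.1 == k)%:R * t (sig x) a)))/=.
  rewrite (bigD1 x.1.1)//= [X in _ = _ + X]big1 ?addr0.
    by apply: eq_bigr => a _; rewrite eqxx mul1r.
  move=> k; rewrite eq_sym => /negbTE kx; apply: big1 => a _.
  by rewrite kx mul0r mulr0.
rewrite expect_sum; last by move=> ka x; exact: state_weight_le1.
rewrite -(pair_bigA _ (fun k a =>
  F k a * \int[u]_x ((x.1.1 == k)%:R * t (sig x) a)))/=.
apply: eq_bigr => k _; rewrite mulr_sumr; apply: eq_bigr => a _.
by rewrite -state_mass_cond_strategy mulrCA.
Qed.

End cond_strategy_lemmas.

(** * Reliability of the guesses *)

(** By countable additivity over the values of the signal. *)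
Lemma le_measure_signalwise (R : realType) (K : pointedFinType)
    (C D : pointedCountType) (u : info_structure R K C D) (S : countType)
    (sig : info_space K C D -> S) (A B : set (info_space K C D)) (a : R) :
  0 <= a ->
  (forall s, (a%:E * u (A `&` [set x | sig x = s]) <=
              u (B `&` [set x | sig x = s]))%E) ->
  (a%:E * u A <= u B)%E.
Proof.
move=> a0 le_fib.
have split_sig E : (u E =
    \sum_(n <oo) u (E `&` [set x | pickle (sig x) = n]))%E.
  rewrite -measure_semi_bigcup//; last first.
    apply/trivIsetP => i j _ _ ij; apply/seteqP; split => // x [[_ xi] [_ xj]].
    by move/eqP: ij; rewrite -xi -xj.
  congr (u _); apply/seteqP; split => [x Ex|x [n _ []//]].
  by exists (pickle (sig x)).
rewrite (split_sig A) (split_sig B) -nneseriesZl//.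
apply: lee_nneseries => [n _ _|n _]; first by rewrite mule_ge0 ?lee_fin.
have [[x0 x0n]|nx] := pselect (exists x0, pickle (sig x0) = n).
  rewrite (_ : [set x | _] = [set x | sig x = sig x0]); first exact: le_fib.
  apply/seteqP; split => x /=; last by move=> ->.
  by rewrite -x0n => /(pcan_inj pickleK).
rewrite (_ : [set x | _] = set0) ?setI0 ?measure0 ?mule0//.
by apply/seteqP; split => // x xn; case: nx; exists x.
Qed.

(** The reliable signals have mass at least 1 - eps and are right with
    conditional probability at least 1 - eps, and (1 - eps)^2 >= 1 - 2 eps. *)
Lemma guess_correct_mass (R : realType) (K : pointedFinType)
    (C D : pointedCountType) (u : info_structure R K C D) (S : countType)
    (sig : info_space K C D -> S) (kappa : S -> K) (eps : R) :
  0 <= eps ->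
  ((1 - eps)%:E <= u [set x | (1 - eps <=
     cond_prob u [set y | y.1.1 = kappa (sig x)]
                 [set y | sig y = sig x])%R])%E ->
  ((1 - 2 * eps)%:E <= u [set x | x.1.1 = kappa (sig x)])%E.
Proof.
move=> eps0; set good := [set x | _] => ugood; set B := [set x | _].
have [eps1|eps1] := leP eps 1; last first.
  (* If eps > 1, the claimed lower bound is negative. *)
  by apply: (@le_trans _ _ 0%E); rewrite ?lee_fin//; lra.
apply: (@le_trans _ _ ((1 - eps)%:E * u good)%E).
  move: ugood; rewrite -info_fineK -EFinM !lee_fin; nra.
apply: (@le_measure_signalwise _ _ _ _ _ _ sig) => [|s]; first lra.
have [[x [gx xs]]|ng] := pselect ((good `&` [set x | sig x = s]) !=set0);
  last first.
  rewrite (_ : good `&` _ = set0) ?measure0 ?mule0//.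
  by apply/seteqP; split => // x Px; case: ng; exists x.
apply: (@le_trans _ _ ((1 - eps)%:E * u [set x | sig x = s])%E).
  apply: lee_pmul => //; first by rewrite lee_fin; lra.
  by apply: le_measure; rewrite ?inE// => y [].
rewrite (_ : B `&` _ =
    [set y | y.1.1 = kappa s] `&` [set y | sig y = s]); last first.
  by apply/seteqP; split => y /= [] + ys; rewrite /B/= ys.
have: 1 - eps <= cond_prob u [set y | y.1.1 = kappa s] [set y | sig y = s].
  by move: gx; rewrite /good/= xs.
rewrite /cond_prob -(info_fineK u (_ `&` _)).
rewrite -(info_fineK u [set y | sig y = s]).
rewrite -EFinM lee_fin /=; set q := fine (u [set y | sig y = s]).
have q0 : 0 <= q by rewrite fine_ge0.
(* A signal of mass zero satisfies the product form of the bound trivially. *)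
have [->|qn0] := eqVneq q 0; first by rewrite mulr0 fine_ge0.
by rewrite ler_pdivlMr// lt_def qn0.
Qed.

(** * Comparison of the two games *)

Section payoffs.
Context (R : realType) (K : pointedFinType) (C D : pointedCountType).
Context (I J : finType) (g : K -> I -> J -> R).
Context (g1 : forall k i j, -1 <= g k i j <= 1).

Lemma expected_payoff_le1 (u : info_structure R K C D) s t :
  behavior_strategy R C I s -> behavior_strategy R D J t ->
  `|expected_payoff u g s t| <= 1.
Proof.
move=> sP tP.
have b x : `|stage_payoff (g x.1.1) (s x.1.2) (t x.2)| <= 1.
  exact: stage_payoff_le1 (g1 _) (sP _) (tP _).
apply: le_trans (le_normr_Rintegral _ _) _ => //.
  exact: info_integrable b.
apply: (@le_trans _ _ (\int[u]_x 1)).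
  apply: le_Rintegral => //.
  - by apply: (@info_integrable _ _ _ _ _ _ 1) => x; rewrite normr_id; exact: b.
  - by apply: (@info_integrable _ _ _ _ _ _ 1) => x; rewrite normr1.
  - by move=> x _; exact: b.
rewrite Rintegral_cst// mul1r -lee_fin info_fineK; exact: probability_le1.
Qed.

Lemma expect_stage_payoff_state (u : info_structure R K C D) s t :
  \int[u]_x stage_payoff (g x.1.1) (s x.1.1) (t x.1.1) =
  \sum_k state_mass u k * stage_payoff (g k) (s k) (t k).
Proof.
exact: (expect_fun_state u (fun k => stage_payoff (g k) (s k) (t k))).
Qed.

Lemma expect_stage_payoff_signal1 (u : info_structure R K C D) s t :
  behavior_strategy R C I s ->
  \int[u]_x stage_payoff (g x.1.1) (s x.1.2) (t x.1.1) =
  \sum_k state_mass u k *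
    stage_payoff (g k) (cond_strategy u (fun x => x.1.2) s k) (t k).
Proof.
move=> sP; under eq_bigr do rewrite stage_payoff_row.
rewrite -(expect_cond_strategy _ _ sP (fun k i => \sum_j t k j * g k i j)).
by apply: eq_Rintegral => x _; rewrite stage_payoff_row.
Qed.

Lemma expect_stage_payoff_signal2 (u : info_structure R K C D) s t :
  behavior_strategy R D J t ->
  \int[u]_x stage_payoff (g x.1.1) (s x.1.1) (t x.2) =
  \sum_k state_mass u k *
    stage_payoff (g k) (s k) (cond_strategy u (fun x => x.2) t k).
Proof.
move=> tP; under eq_bigr do rewrite stage_payoff_col.
rewrite -(expect_cond_strategy _ _ tP (fun k j => \sum_i s k i * g k i j)).
by apply: eq_Rintegral => x _; rewrite stage_payoff_col.
Qed.

End payoffs.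

(** The signals may be replaced by the state since they agree almost surely:
    both inequalities are [expect_le_of_likely] with delta = 0. *)
Lemma expected_payoff_revealed (R : realType) (K : pointedFinType)
    (I J : finType) (g : K -> I -> J -> R) (v : info_structure R K K K) s t :
  (forall k i j, -1 <= g k i j <= 1) ->
  v [set x : info_space K K K | x.1.1 = x.1.2 /\ x.1.2 = x.2] = 1%E ->
  behavior_strategy R K I s -> behavior_strategy R K J t ->
  expected_payoff v g s t =
  \sum_k state_mass v k * stage_payoff (g k) (s k) (t k).
Proof.
move=> g1 diagv sP tP; rewrite -expect_stage_payoff_state.
have b (x y z : K) : `|stage_payoff (g x) (s y) (t z)| <= 1.
  exact: stage_payoff_le1 (g1 _) (sP _) (tP _).
set A := [set x | _] in diagv.
have vA : ((1 - 0)%:E <= v A)%E by rewrite subr0 diagv.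
apply/eqP; rewrite eq_le; apply/andP; split;
  rewrite -[leRHS]addr0 -[X in _ + X](mulr0 2);
  apply: (expect_le_of_likely _ _ _ vA) => [x|x|[[x y] z] [/= <- <-]//];
  exact: b.
Qed.

(** Player 2 guesses the state by kappa and replies to s in u as t' replies in v
    to the average of s given the state. *)
Lemma game_value_le_revealed (R : realType) (K : pointedFinType)
    (C D : pointedCountType) (I J : finType) (g : K -> I -> J -> R)
    (u : info_structure R K C D) (v : info_structure R K K K)
    (kappa : D -> K) (delta : R) :
  payoff_function g -> marg_state v = marg_state u ->
  v [set x : info_space K K K | x.1.1 = x.1.2 /\ x.1.2 = x.2] = 1%E ->
  ((1 - delta)%:E <= u [set x : info_space K C D | x.1.1 = kappa x.2])%E ->
  game_value u g <= game_value v g + 2 * delta.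
Proof.
move=> [I0 J0 g1] margvu diagv likely.
apply: (@maxmin_le _ _ _ _ _ _ _ _ _ _ _ 1).
- exact: behavior_strategy_nonempty.
- exact: behavior_strategy_nonempty.
- by move=> s t; exact: expected_payoff_le1.
- by move=> s t; exact: expected_payoff_le1.
move=> s sP; exists (cond_strategy u (fun x => x.1.2) s).
  exact: cond_strategyP.
move=> t' tP; exists (t' \o kappa) => [d|]; first exact: tP.
rewrite expected_payoff_revealed//; last exact: cond_strategyP.
rewrite /state_mass margvu -expect_stage_payoff_signal1//.
apply: (expect_le_of_likely _ _ _ likely) => [x|x|x /= ->//];
  exact: stage_payoff_le1 (g1 _) (sP _) (tP _).
Qed.

(** Player 1 guesses the state by kappa and plays s' in u; the average given the
    state of a reply t in u is a reply to s' in v. *)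
Lemma revealed_le_game_value (R : realType) (K : pointedFinType)
    (C D : pointedCountType) (I J : finType) (g : K -> I -> J -> R)
    (u : info_structure R K C D) (v : info_structure R K K K)
    (kappa : C -> K) (delta : R) :
  payoff_function g -> marg_state v = marg_state u ->
  v [set x : info_space K K K | x.1.1 = x.1.2 /\ x.1.2 = x.2] = 1%E ->
  ((1 - delta)%:E <= u [set x : info_space K C D | x.1.1 = kappa x.1.2])%E ->
  game_value v g <= game_value u g + 2 * delta.
Proof.
move=> [I0 J0 g1] margvu diagv likely.
apply: (@maxmin_le _ _ _ _ _ _ _ _ _ _ _ 1).
- exact: behavior_strategy_nonempty.
- exact: behavior_strategy_nonempty.
- by move=> s t; exact: expected_payoff_le1.
- by move=> s t; exact: expected_payoff_le1.
move=> s' sP; exists (s' \o kappa) => [c|t tP]; first exact: sP.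
exists (cond_strategy u (fun x => x.2) t); first exact: cond_strategyP.
rewrite expected_payoff_revealed//; last exact: cond_strategyP.
rewrite /state_mass margvu -expect_stage_payoff_signal2//.
apply: (expect_le_of_likely _ _ _ likely) => [x|x|x /= ->//];
  exact: stage_payoff_le1 (g1 _) (sP _) (tP _).
Qed.

Theorem proposition6 (R : realType) (K : pointedFinType)
    (C D : pointedCountType) (eps : R)
    (u : info_structure R K C D) (v : info_structure R K K K)
    (hK : (2 <= #|K|)%N) (heps : 0 <= eps)
    (hu : eps_knowledge eps u)
    (hmarg : marg_state v = marg_state u)
    (hv : v [set x : info_space K K K | x.1.1 = x.1.2 /\ x.1.2 = x.2] = 1%E) :
  (value_dist u v <= (20 * eps)%:E)%E.
Proof.
have [kappa [know1 know2]] := hu.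
have likely1 := guess_correct_mass (sig := fun x => x.1.2)
  (kappa := kappa \o inl) heps know1.
have likely2 := guess_correct_mass (sig := fun x => x.2)
  (kappa := kappa \o inr) heps know2.
apply: ge_ereal_sup => _ [I [J [g [gP ->]]]]; rewrite lee_fin.
have le_uv := game_value_le_revealed gP hmarg hv likely2.
have le_vu := revealed_le_game_value gP hmarg hv likely1.
rewrite ler_norml; lra.
Qed.
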